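(* One has \[ \lim_{n\to\infty}\frac{A_n(z)}{n!}\,\frac{(\log z)^{n+1}}{(z-1)^n}=\frac{z-1}{z} \] uniformly on compact subsets of $\mathbb{C}\setminus(-\infty,0]$.
   Context: The Eulerian polynomials $(A_n(x))_{n\ge0}$ are defined by the exponential generating function \[ \sum_{n=0}^{\infty} A_n(x)\,\frac{t^n}{n!}=\frac{1-x}{e^{t(x-1)}-x},\qquad x\neq1 \] (so $A_0=A_1=1$, $A_2(x)=1+x$, $A_3(x)=1+4x+x^2$, and $A_n$ has degree $n-1$ for $n\ge1$). Here $\log$ is the principal branch of the logarithm. The value at $z=1$ of the expression under the limit is defined by its limit as $z\to1$, which is $0$. *)

(* Defs.v *)
From HB Require Import structures.
From mathcomp Require Import all_boot all_order all_algebra.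
From mathcomp Require Import complex.
From mathcomp Require Import all_classical all_reals all_analysis.

Set Implicit Arguments.
Unset Strict Implicit.
Unset Printing Implicit Defensive.

Import Order.TTheory GRing.Theory Num.Theory.
Import numFieldNormedType.Exports.

Local Open Scope classical_set_scope.
Local Open Scope ring_scope.
Local Open Scope complex_scope.

(* The library puts the topology given by the modulus on R[i]^o only; it is
   copied here to R[i] itself. *)
#[warning="-redundant-canonical-projection"]
HB.instance Definition _ (R : realType) := NormedModule.copy R[i] R[i]^o.

Definition cexp (R : realType) (z : R[i]) : R[i] :=
  (expR (complex.Re z))%:C * (cos (complex.Im z) +i* sin (complex.Im z)).

(* The principal argument, in ]-pi, pi], of a nonzero complex number. *)
Definition carg (R : realType) (z : R[i]) : R :=
  let a := acos (complex.Re z / Normc.normc z) in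
  if 0 <= complex.Im z then a else - a.

Definition clog (R : realType) (z : R[i]) : R[i] := ln (Normc.normc z) +i* carg z.

Definition slit_plane (R : realType) : set R[i] :=
  ~` [set z | complex.Re z <= 0 /\ complex.Im z = 0].

(* A is the sequence of Eulerian polynomials.  For fixed x <> 1 the right-hand
   side is analytic in t near 0, but it has poles: the identity is between
   values for t in a neighbourhood of 0 that may depend on x. *)
Definition is_eulerian (R : realType) (A : nat -> {poly R[i]}) : Prop :=
  forall x : R[i], x != 1 -> \forall t \near (0 : R[i]),
    series (fun n => (A n).[x] * (t ^+ n / (n`!)%:R)) @ \oo -->
      ((1 - x) / (cexp (t * (x - 1)) - x) : R[i]).

(* At z = 1 the quotient is singular; 0 is its limit there. *)
Definition eulerian_ratio (R : realType) (A : nat -> {poly R[i]}) (n : nat)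
    (z : R[i]) : R[i] :=
  if z == 1 then 0
  else (A n).[z] / (n`!)%:R * (clog z ^+ n.+1 / (z - 1) ^+ n).

(* Main.v *)
(* Put L = log z and c_n = A_n(z) / (n! (z - 1)^n). The c_n are the Taylor
   coefficients in s of (1 - z) / (e^s - z), whose poles are the L + 2 pi i k, and
   the simple pole at L contributes (z - 1) / z * L^-(n+1) to c_n. To see that the
   other poles are negligible without complex analysis, replace e^s by
   (1 + s/N)^N with N odd: the zeros s_k = N (rho_k - 1) of (1 + s/N)^N - z, where
   rho_k^N = z, are simple, and c_n becomes the finite sum
   (z - 1) / z * sum_k rho_k s_k^-(n+1); this follows from the vanishing of the
   power sums of the rho_k. The moduli |s_k| are explicit, and bounding them below
   gives, as N grows,
     |c_n L^(n+1) z / (z - 1) - 1| <= 4 |L|^2 (|L| / |L'|)^(n-1)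
   where L' = Re L + i (2 pi - |Im L|). On a compact subset of the slit plane |L| is
   bounded and |L| / |L'| stays away from 1. *)
Require Import Defs.
From mathcomp Require Import all_boot all_order all_algebra.
From mathcomp Require Import complex ring lra.
From mathcomp Require Import all_classical all_reals all_analysis.
Import Order.TTheory GRing.Theory Num.Theory.
Import numFieldNormedType.Exports.
Local Open Scope classical_set_scope.
Local Open Scope ring_scope.
Local Open Scope complex_scope.
Set Implicit Arguments.
Unset Strict Implicit.
Unset Printing Implicit Defensive.

Local Notation nm := (@Normc.normc _).

(** * The real-valued modulus on the complex numbers and limits of sequences *)

Section ComplexModulus.
Variable R : realType.
Implicit Types (x y z : R[i]) (a b e : R) (u v : nat -> R[i]).

(** The library norm on [R[i]] takes its values in [R[i]]. Estimates are carried out with the real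
    number [nm z], and this equation transfers them. *)
Lemma normE z : `|z| = (nm z)%:C. Proof. by case: z => a b; rewrite normc_def. Qed.

Lemma normc_ge0 z : 0 <= nm z.
Proof. by rewrite -lecR -normE normr_ge0. Qed.

Lemma normc_eq0 z : (nm z == 0) = (z == 0).
Proof. by apply/eqP/eqP => [/Normc.eq0_normc //|->]; rewrite Normc.normc0. Qed.

Lemma normc_gt0 z : (0 < nm z) = (z != 0).
Proof. by rewrite lt0r normc_eq0 normc_ge0 andbT. Qed.

Lemma normcR a : nm a%:C = `|a|.
Proof. by rewrite /Normc.normc /= expr0n /= addr0 sqrtr_sqr. Qed.

Lemma normcX z n : nm (z ^+ n) = nm z ^+ n.
Proof.
by elim: n => [|n IH]; rewrite ?expr0 ?Normc.normc1// !exprS Normc.normcM IH.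
Qed.

Lemma normcBC x y : nm (x - y) = nm (y - x).
Proof. by rewrite -normcN opprB. Qed.

Lemma normc_sum I (r : seq I) (P : pred I) (F : I -> R[i]) :
  nm (\sum_(i <- r | P i) F i) <= \sum_(i <- r | P i) nm (F i).
Proof.
elim/big_rec2: _ => [|i y x _ le]; first by rewrite Normc.normc0.
by apply: le_trans (le_normcD _ _) _; rewrite lerD2l.
Qed.

Lemma normc_distD x y z : nm (x - z) <= nm (x - y) + nm (y - z).
Proof. by apply: le_trans (le_normcD _ _); rewrite addrA subrK. Qed.

Lemma dist_normc x y : `|nm x - nm y| <= nm (x - y).
Proof.
have H p q : nm p - nm q <= nm (p - q).
  by rewrite lerBlDr; apply: le_trans (le_normcD _ _); rewrite subrK.
by rewrite ler_norml H lerNl opprB normcBC H.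
Qed.

Lemma cvgcP u x :
  u @ \oo --> x <-> (forall e, 0 < e -> \forall n \near \oo, nm (x - u n) < e).
Proof.
split=> [/cvgrPdist_lt H e e0|H].
  have /H : 0 < e%:C by rewrite ltcR.
  by apply: filterS => n; rewrite normE ltcR.
(* A positive complex number has imaginary part 0, so a complex tolerance is a real one. *)
apply/cvgrPdist_lt => -[e e']; rewrite ltcE /= => /andP[/eqP-> /H].
by apply: filterS => n; rewrite normE ltcR.
Qed.

Lemma cvg_normc u x : u @ \oo --> x -> (fun n => nm (u n)) @ \oo --> nm x.
Proof.
move=> /cvgcP H; apply/cvgrPdist_lt => e /H; apply: filterS => n.
by apply: le_lt_trans; exact: dist_normc.
Qed.

Lemma cvg_complex (a_ b_ : nat -> R) a b :
  a_ @ \oo --> a -> b_ @ \oo --> b -> (fun n => a_ n +i* b_ n) @ \oo --> a +i* b.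
Proof.
move=> Ha Hb; apply/cvgcP => e e0; have e2 : 0 < e / 2 by rewrite divr_gt0.
move/cvgrPdist_lt : Ha => /(_ _ e2); apply: filter_app.
move/cvgrPdist_lt : Hb => /(_ _ e2); apply: filterS => n hb ha.
have -> : (a +i* b) - (a_ n +i* b_ n) =
    (a - a_ n)%:C + (b - b_ n)%:C * 'i%C by simpc.
apply: le_lt_trans (le_normcD _ _) _.
rewrite Normc.normcM !normcR [nm 'i%C]/= expr0n/= add0r expr1n sqrtr1 mulr1.
by rewrite [ltRHS](splitr e) ltrD.
Qed.

Lemma cvg_sumc I (r : seq I) (F : I -> nat -> R[i]) (G : I -> R[i]) :
  (forall i, F i @ \oo --> G i) ->
  (fun n => \sum_(i <- r) F i n) @ \oo --> \sum_(i <- r) G i.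
Proof.
move=> H; elim: r => [|i r IH].
  rewrite big_nil; under eq_fun do rewrite big_nil; exact: cvg_cst.
rewrite big_cons; under eq_fun do rewrite big_cons.
exact: (cvgD (H i) IH).
Qed.

Lemma cvg_Xc u x n : u @ \oo --> x -> (fun k => u k ^+ n) @ \oo --> x ^+ n.
Proof.
move=> H; elim: n => [|n IH]; first exact: cvg_cst.
rewrite exprS; under eq_fun do rewrite exprS.
exact: (cvgM H IH).
Qed.

Lemma cvg_normcX u x n :
  u @ \oo --> x -> (fun k => nm (u k) ^+ n) @ \oo --> nm x ^+ n.
Proof.
move=> H; rewrite -normcX.
have -> : (fun k => nm (u k) ^+ n) = (fun k => nm (u k ^+ n)).
  by apply/funext => k; rewrite normcX.
exact: (cvg_normc (cvg_Xc H)).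
Qed.

End ComplexModulus.

(** * Power sums over the roots of an N-th power equation *)

Section RootSums.
Variables (F : fieldType) (N : nat) (z : F) (rho : 'I_N -> F).
Hypothesis rhoN : forall k, rho k ^+ N = z.
Hypothesis rho_neq1 : forall k, rho k != 1.
Hypothesis rho_sum : forall l, (0 < l < N)%N -> \sum_k rho k ^+ l = 0.

(** Expand (rho - 1)^m by the binomial theorem: power sums with exponents 1, ..., m + 1 appear, and
    all vanish except the one with exponent N, which is present only if m + 1 = N. *)
Lemma sum_root_shift m : (m < N)%N ->
  \sum_k rho k * (rho k - 1) ^+ m = if m.+1 == N then N%:R * z else 0.
Proof.
move=> mN; pose f l k := (-1) ^+ (m - l) * rho k ^+ l.+1 *+ 'C(m, l).
have -> : \sum_k rho k * (rho k - 1) ^+ m = \sum_(l < m.+1) \sum_k f l k.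
  rewrite exchange_big /=; apply: eq_bigr => k _.
  rewrite addrC exprDn big_distrr /=; apply: eq_bigr => l _.
  by rewrite mulrnAr mulrCA -exprS.
have fE l : \sum_k f l k = (-1) ^+ (m - l) * (\sum_k rho k ^+ l.+1) *+ 'C(m, l).
  by rewrite /f sumrMnl -mulr_sumr.
rewrite big_ord_recr /= [X in X + _]big1 ?add0r => [|[l lm] _ /=]; last first.
  by rewrite fE rho_sum ?mulr0 ?mul0rn// (leq_ltn_trans _ mN).
rewrite fE subnn expr0 mul1r binn mulr1n.
case: eqP => [->|/eqP mN']; last by rewrite rho_sum //= ltn_neqAle mN' mN.
under eq_bigr do rewrite rhoN.
by rewrite sumr_const card_ord mulr_natl.
Qed.

(** With tau = rho - 1, expand z = (1 + tau)^N in powers of tau. The terms with j <= n cancel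
    against the left-hand sum; dividing the others by tau^(n+1) leaves nonnegative powers of tau,
    which [sum_root_shift] evaluates. The only surviving power is tau^(N-1), and it occurs only for
    n = 0. *)
Lemma root_sum_rec n : (n < N)%N ->
  let e m := \sum_k rho k * (rho k - 1) ^- m.+1 in
  \sum_(j < n.+1) 'C(N, j)%:R * e (n - j)%N - z * e n =
    if n == 0%N then - (N%:R * z) else 0.
Proof.
move=> nN /=.
have tau0 k : rho k - 1 != 0 by rewrite subr_eq0 rho_neq1.
have zE k : z = \sum_(j < N.+1) 'C(N, j)%:R * (rho k - 1) ^+ j.
  rewrite -(rhoN k) -{1}[rho k](subrK 1) addrC exprDn.
  by apply: eq_bigr => j _; rewrite expr1n mul1r mulr_natl.
have -> : \sum_(j < n.+1) 'C(N, j)%:R *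
      (\sum_k rho k * (rho k - 1) ^- (n - j).+1) =
    \sum_k rho k * (rho k - 1) ^- n.+1 *
      \sum_(j < n.+1) 'C(N, j)%:R * (rho k - 1) ^+ j.
  under eq_bigr do rewrite mulr_sumr.
  rewrite exchange_big /=; apply: eq_bigr => k _.
  rewrite mulr_sumr; apply: eq_bigr => -[j /= jn] _.
  rewrite mulrCA -!mulrA; congr (_ * _); rewrite mulrCA; congr (_ * _).
  apply: (mulIf (expf_neq0 (n - j).+1 (tau0 k))); rewrite mulVf ?expf_neq0//.
  by rewrite -mulrA -exprD addnS subnKC// mulVf ?expf_neq0.
rewrite mulr_sumr -sumrB.
have -> : \sum_k (rho k * (rho k - 1) ^- n.+1 *
      (\sum_(j < n.+1) 'C(N, j)%:R * (rho k - 1) ^+ j) -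
      z * (rho k * (rho k - 1) ^- n.+1)) =
    - \sum_(m < N - n) 'C(N, m + n.+1)%:R * \sum_k rho k * (rho k - 1) ^+ m.
  under [in RHS]eq_bigr do rewrite mulr_sumr.
  rewrite [in RHS]exchange_big -sumrN /=; apply: eq_bigr => k _.
  rewrite {1}(zE k) -(big_mkord xpredT (fun j => 'C(N, j)%:R * (rho k - 1) ^+ j)).
  rewrite -(big_mkord xpredT (fun j => 'C(N, j)%:R * (rho k - 1) ^+ j)).
  rewrite [in X in _ - X](big_cat_nat _ (n := n.+1))//=; last exact: leqW.
  rewrite mulrC -mulrBl opprD addrA subrr add0r mulNr; congr (- _).
  rewrite -{1}[n.+1]add0n big_addn subSS big_mkord mulr_suml.
  apply: eq_bigr => m _; rewrite exprD.
  have := expf_neq0 n.+1 (tau0 k).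
  by move: (_ ^+ m) (_ ^+ n.+1) => t1 t2 t20; field.
have sumE m : (m < N - n)%N ->
    'C(N, m + n.+1)%:R * (\sum_k rho k * (rho k - 1) ^+ m) =
    if (n == 0%N) && (m.+1 == N) then N%:R * z else 0.
  move=> mNn; have mN : (m < N)%N by apply: leq_trans mNn (leq_subr _ _).
  rewrite sum_root_shift//; case: eqP => [mE|_]; last by rewrite andbF mulr0.
  have n0 : n = 0%N by move: mNn; rewrite -mE; case: (n) => // n'; rewrite subSS ltnNge leq_subr.
  by rewrite n0 addn1 mE binn mul1r.
under eq_bigr => m _ do rewrite sumE//.
case: eqP => [n0|_] /=; last by rewrite big1 ?oppr0.
rewrite n0 subn0; case: {sumE} N nN => // N' _.
by rewrite big_ord_recr/= eqxx big1 ?add0r// => m _; rewrite eqSS ltn_eqF.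
Qed.
End RootSums.

(** * Taylor coefficients from values on a real interval *)

Section TaylorCoefficients.
Variable R : realType.
Implicit Types (c : nat -> R[i]) (x z : R[i]) (s : R).

Lemma cvgc_bounded (u : nat -> R[i]) x :
  u @ \oo --> x -> exists2 B : R, 0 < B & forall n, nm (u n) <= B.
Proof.
move=> Hu; have /(@cvg_seq_bounded R R^o) : cvgn (fun n => nm (u n)).
  by apply/cvg_ex; exists (nm x); exact: cvg_normc.
move=> /pinfty_ex_gt0[B B0 HB]; exists B => // n.
by have := HB n I; rewrite /= ger0_norm// normc_ge0.
Qed.

Lemma cvg_normc_le (u : nat -> R[i]) x (B : R) :
  u @ \oo --> x -> (\forall n \near \oo, nm (u n) <= B) -> nm x <= B.
Proof.
move=> /cvg_normc Hu HB; apply: (ler_cvg_to Hu (cvg_cst B)); exact: HB.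
Qed.

(** Convergence at q = r/2 bounds c_k q^k. For |s| <= q/2 the tail is then dominated by a geometric
    series of ratio |s|/q <= 1/2. *)
Lemma taylor_remainder c (f : R -> R[i]) (r : R) n : 0 < r ->
  (forall s, `|s| < r -> series (fun k => c k * s%:C ^+ k) @ \oo --> f s) ->
  exists M d : R, [/\ 0 <= M, 0 < d &
    forall s, `|s| <= d -> nm (\sum_(k < n) c k * s%:C ^+ k - f s) <= M * `|s| ^+ n].
Proof.
move=> r0 Hf; pose q : R := r / 2; have q0 : 0 < q by rewrite divr_gt0.
have /Hf/cvgc_bounded[B B0 HB] : `|q| < r by rewrite gtr0_norm// /q; lra.
have Hc k : nm (c k) * q ^+ k <= 2 * B.
  rewrite -{1}(gtr0_norm q0) -normcR -normcX -Normc.normcM.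
  have -> : c k * q%:C ^+ k = series (fun k => c k * q%:C ^+ k) k.+1 -
      series (fun k => c k * q%:C ^+ k) k by rewrite seriesSB.
  by apply: le_trans (le_normcD _ _) _; rewrite normcN mulr2n mulrDl !mul1r lerD.
exists (4 * B / q ^+ n), (q / 2); split.
- by rewrite divr_ge0 ?exprn_ge0 ?mulr_ge0// ltW.
- by rewrite divr_gt0.
move=> s sq; have sr : `|s| < r by apply: le_lt_trans sq _; rewrite /q; lra.
have s0 : 0 <= `|s| by [].
pose p := `|s| / q; have p0 : 0 <= p by rewrite divr_ge0// ltW.
have p2 : p <= 2^-1 by rewrite /p ler_pdivrMr// mulrC.
(* The factor 2 - 2 * 2^-d is the sum of the first [d] powers of 1/2, kept in closed form for the
   induction. *)
have step d : nm (series (fun k => c k * s%:C ^+ k) (n + d)%N -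
    series (fun k => c k * s%:C ^+ k) n) <= 2 * B * p ^+ n * (2 - 2 * 2^-1 ^+ d).
  elim: d => [|d IH].
    by rewrite addn0 subrr Normc.normc0 expr0 mulr1 subrr mulr0.
  apply: le_trans (normc_distD _ (series (fun k => c k * s%:C ^+ k) (n + d)%N) _) _.
  rewrite addnS seriesSB.
  have h1 : nm (c (n + d)%N * s%:C ^+ (n + d)) <= 2 * B * p ^+ (n + d).
    rewrite Normc.normcM normcX normcR.
    have -> : nm (c (n + d)%N) * `|s| ^+ (n + d) =
        nm (c (n + d)%N) * q ^+ (n + d) * p ^+ (n + d).
      by rewrite -mulrA -exprMn /p mulrCA divff ?mulr1// gt_eqF.
    by rewrite ler_wpM2r// exprn_ge0.
  have h2 : p ^+ (n + d) <= p ^+ n * 2^-1 ^+ d.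
    by rewrite exprD ler_wpM2l ?exprn_ge0// lerXn2r// nnegrE.
  have h3 : 2 * B * p ^+ (n + d) <= 2 * B * (p ^+ n * 2^-1 ^+ d).
    by rewrite ler_wpM2l// mulr_ge0// ltW.
  apply: le_trans (lerD (le_trans h1 h3) IH) _.
  rewrite exprS; move: (_ ^+ d) (p ^+ n) => e t; rewrite le_eqVlt; apply/orP; left; apply/eqP.
  by field.
have {}step m : (n <= m)%N -> nm (series (fun k => c k * s%:C ^+ k) m -
    series (fun k => c k * s%:C ^+ k) n) <= 4 * B / q ^+ n * `|s| ^+ n.
  move=> /subnKC <-; apply: le_trans (step _) _.
  have -> : 4 * B / q ^+ n * `|s| ^+ n = 2 * B * p ^+ n * 2.
    rewrite /p (expr_div_n `|s| q n); have : q ^+ n != 0 by rewrite expf_neq0// gt_eqF.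
    by move: (q ^+ n) (`|s| ^+ n) => t1 t2 t10; field.
  rewrite ler_wpM2l ?mulr_ge0 ?exprn_ge0 ?(ltW B0)//.
  by rewrite gerBl mulr_ge0// exprn_ge0.
rewrite normcBC -(big_mkord xpredT (fun k => c k * s%:C ^+ k)).
rewrite -[\sum_(0 <= k < n) _]/(series (fun k => c k * s%:C ^+ k) n).
apply: cvg_normc_le; first by apply: (cvgB (Hf _ sr)); exact: cvg_cst.
by exists n => // m /= /step.
Qed.

Lemma polyC_bound (p : {poly R[i]}) s : `|s| <= 1 ->
  nm p.[s%:C] <= \sum_(i < size p) nm p`_i.
Proof.
move=> s1; rewrite horner_coef; apply: le_trans (normc_sum _ _ _) _.
apply: ler_sum => i _; rewrite Normc.normcM normcX normcR.
by rewrite ler_piMr ?normc_ge0// exprn_ile1.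
Qed.

(** Letting s tend to 0 kills the constant coefficient; dividing by ['X] then lowers the order of
    vanishing by one, and induction applies. *)
Lemma poly_littleo_coef (p : {poly R[i]}) n (M d : R) : 0 < d ->
  (forall s, 0 < s <= d -> nm p.[s%:C] <= M * s ^+ n) ->
  forall j, (j < n)%N -> p`_j = 0.
Proof.
(* With d <= 1, powers of s are at most 1 and [polyC_bound] applies. *)
wlog d1 : d / d <= 1 => [H d0 Hp|].
  apply: (H (Num.min d 1)); first by rewrite ge_min lexx orbT.
    by rewrite lt_min d0 ltr01.
  by move=> s /andP[s0]; rewrite le_min => /andP[sd _]; apply: Hp; rewrite s0.
elim: n p => [//|n IH] p d0 Hp.
have p0 : p`_0 = 0.
  elim/poly_ind: p Hp => [|p a _] Hp; first by rewrite coef0.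
  rewrite coefD coefMX coefC !eqxx add0r.
  set B := \sum_(i < size p) nm p`_i.
  have B0 : 0 <= B by apply: sumr_ge0 => i _; exact: normc_ge0.
  have M0 : 0 <= M.
    have := Hp d; rewrite d0 lexx => /(_ isT)/(le_trans (normc_ge0 _)).
    by rewrite pmulr_lge0// exprn_gt0.
  have H s : 0 < s <= d -> nm a <= (M + B) * s.
    move=> /[dup] /Hp; rewrite hornerMXaddC => h /andP[s0 sd].
    have -> : a = p.[s%:C] * s%:C + a - p.[s%:C] * s%:C by rewrite addrC addKr.
    apply: le_trans (le_normcD _ _) _; rewrite normcN Normc.normcM normcR mulrDl.
    rewrite lerD//.
      apply: le_trans h _; rewrite exprS ler_wpM2l// ler_piMr ?(ltW s0)//.
      by rewrite exprn_ile1 ?(ltW s0)// (le_trans sd).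
    rewrite gtr0_norm// ler_wpM2r ?(ltW s0)// polyC_bound// gtr0_norm//.
    exact: le_trans sd _.
  apply/eqP; rewrite -normc_eq0 eq_le normc_ge0 andbT.
  rewrite leNgt; apply/negP => a0.
  have MB : 0 <= M + B by rewrite addr_ge0.
  (* This point is small enough that (M + B) t < |a|, against [H]. *)
  pose t := Num.min d (nm a / (M + B + 1) / 2).
  have t0 : 0 < t by rewrite lt_min d0 !divr_gt0// ltr_wpDl.
  have := H t; rewrite t0 ge_min lexx => /(_ isT).
  apply/negP; rewrite -ltNge.
  apply: (@le_lt_trans _ _ ((M + B) * (nm a / (M + B + 1) / 2))).
    by rewrite ler_wpM2l// ge_min lexx orbT.
  have MB1 : 0 < M + B + 1 by rewrite ltr_wpDl.
  rewrite mulrA ltr_pdivrMr// mulrA ltr_pdivrMr//.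
  nra.
have pE : p = \poly_(i < (size p).-1) p`_i.+1 * 'X.
  apply/polyP => i; rewrite coefMX coef_poly; case: i => [|i]; first by rewrite p0.
  rewrite [i.+1 == 0%N]/= [i.+1.-1]/=; case: ltnP => // le.
  by rewrite nth_default//; case: (size p) le.
move: (\poly_(i < _) _) pE => q pE.
have Hq : forall j, (j < n)%N -> q`_j = 0.
  apply: IH => // s /[dup] /Hp; rewrite pE hornerMX => h /andP[s0 sd].
  move: h; rewrite Normc.normcM normcR gtr0_norm// exprSr mulrA.
  by rewrite ler_pM2r.
case=> [_|j jn]; first exact: p0.
by rewrite pE coefMX/= Hq.
Qed.

Lemma expRC_series s :
  series (fun k => (k`!%:R^-1 : R[i]) * s%:C ^+ k) @ \oo --> (expR s)%:C.
Proof.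
have H : series (exp_coeff s) @ \oo --> expR s by exact: is_cvg_series_exp_coeff.
have -> : series (fun k => (k`!%:R^-1 : R[i]) * s%:C ^+ k) =
    (fun n => series (exp_coeff s) n +i* 0).
  apply/funext => n; rewrite -[_ +i* _]/((series (exp_coeff s) n)%:C) /series /=.
  rewrite rmorph_sum; apply: eq_bigr => k _.
  by rewrite rmorphM rmorphXn fmorphV rmorph_nat mulrC.
exact: (cvg_complex H (cvg_cst 0)).
Qed.

(* The recurrence says [(e^s - z) * (sum_k c_k s^k) = 1 - z]. *)
Lemma taylor_recurrence c z (r : R) : 0 < r ->
  (forall s, `|s| < r -> series (fun k => c k * s%:C ^+ k) @ \oo -->
     (1 - z) / ((expR s)%:C - z)) ->
  z != 1 ->
  forall n, \sum_(j < n.+1) j`!%:R^-1 * c (n - j)%N - z * c n =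
    if n == 0%N then 1 - z else 0.
Proof.
move=> r0 Hc z1 n.
have Hexp m := taylor_remainder m ltr01 (fun s _ => @expRC_series s).
have [M1 [d1 [M10 d10 H1]]] := taylor_remainder n.+1 r0 Hc.
have [M2 [d2 [M20 d20 H2]]] := Hexp n.+1.
have [M3 [d3 [M30 d30 H3]]] := Hexp 1%N.
(* [u] and [v] truncate the series of the quotient and of e^s - z. Once u v - (1 - z) is shown to be
   O(s^(n+1)), its coefficient of index n vanishes, and that is the recurrence. *)
pose u : {poly R[i]} := \poly_(k < n.+1) c k.
pose v : {poly R[i]} := \poly_(k < n.+1) k`!%:R^-1 - z%:P.
pose U : R := \sum_(i < size u) nm u`_i; pose V : R := \sum_(i < size v) nm v`_i.
have dz : 0 < nm (1 - z) by rewrite normc_gt0 subr_eq0 eq_sym.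
(* Since |e^s - 1| <= M3 s, taking s <= [d4] keeps e^s away from z. *)
pose d4 := nm (1 - z) / (M3 + 1) / 2.
have M31 : 0 < M3 + 1 by rewrite ltr_wpDl.
have d40 : 0 < d4 by rewrite !divr_gt0.
pose d := Num.min 1 (Num.min (Num.min d1 d2) (Num.min d3 d4)).
have d0 : 0 < d by rewrite !lt_min ltr01 d10 d20 d30 d40.
have small s : 0 < s <= d ->
    nm (u * v - (1 - z)%:P).[s%:C] <= (M1 * V + (U + M1) * M2) * s ^+ n.+1.
  move=> /andP[s0]; rewrite !le_min => /and3P[s1 /andP[sd1 sd2] /andP[sd3 sd4]].
  have sE : `|s| = s by rewrite gtr0_norm.
  have := H1 s; rewrite sE => /(_ sd1) {}H1.
  have := H2 s; rewrite sE => /(_ sd2) {}H2.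
  have := H3 s; rewrite sE => /(_ sd3) {}H3.
  set g := (expR s)%:C - z in H1; set f := (1 - z) / g in H1.
  have g0 : g != 0.
    apply: contraTneq sd4 => /eqP; rewrite subr_eq0 => /eqP ez; rewrite -ltNge.
    move: H3; rewrite big_ord1 expr0 mulr1 fact0 invr1 ez expr1 => H3.
    rewrite /d4 mulrAC ltr_pdivrMr// ltr_pdivrMr//.
    by have := normc_ge0 (1 - z); nra.
  (* As f g = 1 - z, the error u v - f g splits into two terms, each with one small factor. *)
  have -> : (u * v - (1 - z)%:P).[s%:C] =
      (u.[s%:C] - f) * v.[s%:C] + f * (v.[s%:C] - g).
    rewrite hornerD hornerN hornerC hornerM mulrBl mulrBr addrA addrNK.
    by rewrite /f mulfVK.
  have ub : nm (u.[s%:C] - f) <= M1 * s ^+ n.+1 by rewrite /u horner_poly.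
  have vb : nm (v.[s%:C] - g) <= M2 * s ^+ n.+1.
    by rewrite /v /g hornerD hornerN hornerC horner_poly opprB addrA addrNK.
  have ss : `|s| <= 1 by rewrite sE.
  have fb : nm f <= U + M1.
    rewrite -[f](subKr u.[s%:C]); apply: le_trans (le_normcD _ _) _.
    rewrite normcN lerD ?polyC_bound//; apply: le_trans ub _.
    by rewrite ler_piMr// exprn_ile1// ltW.
  apply: le_trans (le_normcD _ _) _; rewrite (Normc.normcM (_ - f)) (Normc.normcM f) mulrDl lerD//.
    by rewrite mulrAC ler_pM ?normc_ge0// polyC_bound.
  by rewrite -[leRHS]mulrA ler_pM ?normc_ge0.
have /(_ n (ltnSn n)) := poly_littleo_coef d0 small.
rewrite coefB coefC mulrC coefM => /eqP; rewrite subr_eq0 => /eqP <-.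
under [RHS]eq_bigr => j _ do
  rewrite coefB coefC !coef_poly ltn_ord ltnS leq_subr mulrBl.
rewrite sumrB; congr (_ - _).
by rewrite big_ord_recl /= subn0 big1 ?addr0// => j _; rewrite mul0r.
Qed.
End TaylorCoefficients.

(** * The recurrence for the normalised Eulerian values *)

Section EulerianRecurrence.
Variables (R : realType) (A : nat -> {poly R[i]}).
Hypothesis hA : is_eulerian A.

(** Putting t = s / (z - 1) turns e^(t (z - 1)) into e^s, so the [c n] are the coefficients in s of
    (1 - z) / (e^s - z). Here s is kept real, with radius the given one times |z - 1|. *)
Lemma eulerian_recurrence (z : R[i]) : z != 1 ->
  let c n := (A n).[z] / n`!%:R / (z - 1) ^+ n in
  forall n, \sum_(j < n.+1) j`!%:R^-1 * c (n - j)%N - z * c n =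
    if n == 0%N then 1 - z else 0.
Proof.
move=> z1 c; have w0 : z - 1 != 0 by rewrite subr_eq0.
have /nbhs_ballP[[e e'] /=] := hA z1.
rewrite ltcE /= => /andP[/eqP-> e0] He {e'}.
have r0 : 0 < e * nm (z - 1) by rewrite mulr_gt0 ?normc_gt0.
apply: (taylor_recurrence r0 _ z1) => s sr.
have /He : ball 0 e%:C (s%:C / (z - 1)).
  rewrite /ball /= sub0r normrN normE ltcR Normc.normcM Normc.normcV normcR.
  by rewrite ltr_pdivrMr// normc_gt0.
have expE : cexp (s%:C / (z - 1) * (z - 1)) = (expR s)%:C.
  rewrite (divfK w0); rewrite /cexp cos0 sin0.
  by rewrite -[1 +i* 0]/(1%:C) mulr1.
rewrite [cexp _]expE.
have -> // : (fun n => (A n).[z] * ((s%:C / (z - 1)) ^+ n / n`!%:R)) =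
  (fun n => c n * s%:C ^+ n).
apply/funext => n; rewrite /c expr_div_n.
move: (s%:C ^+ n) => t; field.
by rewrite expf_neq0//= pnatr_eq0 -lt0n fact_gt0.
Qed.

End EulerianRecurrence.

(** * The complex exponential and the principal logarithm *)

Section ComplexExponential.
Variable R : realType.
Implicit Types (x y z : R[i]) (a b : R).

Lemma cexpD x y : cexp (x + y) = cexp x * cexp y.
Proof.
case: x y => [a b] [c d]; rewrite /cexp /= expRD cosD sinD; simpc.
by congr (_ +i* _); ring.
Qed.

Lemma cexp0 : cexp (0 : R[i]) = 1.
Proof. by rewrite /cexp /= expR0 cos0 sin0 mul1r. Qed.

Lemma cexp_natM n z : cexp (n%:R * z) = cexp z ^+ n.
Proof.
elim: n => [|n IH]; first by rewrite mul0r cexp0.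
by rewrite exprS -IH -cexpD -[n.+1]add1n natrD mulrDl mul1r.
Qed.

Lemma normc_cexp z : nm (cexp z) = expR (complex.Re z).
Proof.
rewrite /cexp Normc.normcM normcR ger0_norm ?expR_ge0//.
by rewrite /Normc.normc cos2Dsin2 sqrtr1 mulr1.
Qed.

Lemma cexp_2piM n : cexp ((2 * pi * n%:R)*i : R[i]) = 1.
Proof.
have -> : (2 * pi * n%:R)*i = n%:R * (2 * pi)*i :> R[i].
  rewrite -(rmorph_nat (real_complex R) n); simpc.
  by rewrite mulrC.
rewrite cexp_natM /cexp /= expR0.
by rewrite mulr_natl cos2pi sin2pi mul1r expr1n.
Qed.

Lemma clogK z : z != 0 -> cexp (clog z) = z.
Proof.
move=> z0; have r0 : 0 < nm z by rewrite normc_gt0.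
rewrite /cexp /clog /= lnK ?posrE//.
case: z z0 r0 => [a b] z0 r0; rewrite /carg /=.
set r := Num.sqrt _ in r0 *.
have r2 : r ^+ 2 = a ^+ 2 + b ^+ 2 by rewrite sqr_sqrtr// addr_ge0 ?sqr_ge0.
have ar : -1 <= a / r <= 1.
  rewrite -ler_norml normrM normrV ?unitfE ?gt_eqF// (gtr0_norm r0).
  rewrite ler_pdivrMr// mul1r -(@ler_pXn2r _ 2%N) ?nnegrE ?(ltW r0)//.
  by rewrite r2 real_normK ?num_real// lerDl sqr_ge0.
have sq : Num.sqrt (1 - (a / r) ^+ 2) = `|b| / r.
  have -> : 1 - (a / r) ^+ 2 = (b / r) ^+ 2.
    rewrite !expr_div_n r2; field.
    by rewrite -r2 expf_neq0// gt_eqF.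
  by rewrite sqrtr_sqr normrM normrV ?unitfE ?gt_eqF// (gtr0_norm r0).
have cE : cos (if 0 <= b then acos (a / r) else - acos (a / r)) = a / r.
  by case: ifP; rewrite ?cosN acosK// in_itv.
have sE : sin (if 0 <= b then acos (a / r) else - acos (a / r)) = b / r.
  case: ifP => b0; rewrite ?sinN sin_acos// sq; first by rewrite ger0_norm.
  by rewrite ltr0_norm ?mulNr ?opprK// ltNge b0.
by rewrite cE sE; simpc; congr (_ +i* _); rewrite mulrC divfK// gt_eqF.
Qed.

(* The half-angle form shows that the modulus grows with [`|b|] on [-pi, pi]. *)
Lemma sqr_normc_cexpB1 a b :
  nm (cexp (a +i* b) - 1) ^+ 2 =
    (expR a - 1) ^+ 2 + 4 * expR a * sin (b / 2) ^+ 2.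
Proof.
rewrite /cexp -(rmorph1 (real_complex R)) /=; simpc.
rewrite /Normc.normc sqr_sqrtr ?addr_ge0 ?sqr_ge0//.
have bE : b = (b / 2) *+ 2 by rewrite -mulr_natr divfK.
rewrite {1 2}bE cos_mulr2n sin_mulr2n.
have h := cos2Dsin2 (b / 2); move: (cos _) (sin _) (expR a) h => c s e h.
have -> : c ^+ 2 = 1 - s ^+ 2 by rewrite -h addrK.
have -> : (e * ((c * s) *+ 2)) ^+ 2 = 4 * e ^+ 2 * s ^+ 2 * c ^+ 2 by ring.
have -> : c ^+ 2 = 1 - s ^+ 2 by rewrite -h addrK.
by ring.
Qed.

End ComplexExponential.

(** * Bounds for sine and cosine, and sums of inverse squares *)

Section Sine.
Variable R : realType.
Implicit Types x y : R.

Lemma sin_le_mono x y : 0 <= x -> x <= y -> y <= pi / 2 -> sin x <= sin y.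
Proof.
move=> x0 + y2; rewrite le_eqVlt => /predU1P[->//|xy]; apply: ltW.
have p0 : 0 <= pi / 2 :> R by rewrite divr_ge0// pi_ge0.
by rewrite ltr_sin// in_itv/=; apply/andP; split; lra.
Qed.

Lemma cos_le_mono x y : 0 <= x -> x <= y -> y <= pi -> cos y <= cos x.
Proof.
move=> x0 + y2; rewrite le_eqVlt => /predU1P[->//|xy]; apply: ltW.
by rewrite ltr_cos// in_itv/=; apply/andP; split; lra.
Qed.

(* Half-angle formula and mean value theorem: [sin x = x cos c cos (x/2)] with
   both angles at most [pi/4]. *)
Lemma sin_ge_half x : 0 <= x -> x <= pi / 2 -> x / 2 <= sin x.
Proof.
move=> x0 x2; have y0 : 0 <= x / 2 by rewrite divr_ge0.
have y4 : x / 2 <= pi / 4 by lra.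
have p0 := pi_ge0 R; have p4 : pi / 4 <= pi :> R by lra.
have [c] := @MVT_segment R sin cos 0 (x / 2) y0 (fun t _ => is_derive_sin t)
  (continuous_subspaceT (@continuous_sin R)).
rewrite in_itv /= => /andP[c0 cx]; rewrite sin0 !subr0 => sE.
rewrite {2}(_ : x = (x / 2) *+ 2); last by rewrite -mulr_natr divfK.
rewrite sin_mulr2n sE; set q : R := cos (pi / 4).
have qc : q <= cos c by rewrite cos_le_mono// (le_trans cx).
have qx : q <= cos (x / 2) by rewrite cos_le_mono.
have q0 : 0 <= q by apply: cos_ge0_pihalf; lra.
have q2 : q ^+ 2 = 1 / 2.
  have := cos_mulr2n (pi / 4 : R).
  rewrite (_ : (pi / 4) *+ 2 = pi / 2); last by rewrite -mulr_natr; field.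
  by rewrite cos_pihalf -/q => h; lra.
have : q * q <= cos (x / 2) * cos c by rewrite ler_pM.
rewrite -expr2 q2 -mulr_natr => h; nra.
Qed.

Lemma sin_sqr_norm x : sin `|x| ^+ 2 = sin x ^+ 2.
Proof. by case: (ger0P x) => // _; rewrite sinN sqrrN. Qed.

Lemma cos_ge1Bx x : 0 <= x -> 1 - x <= cos x.
Proof.
move=> x0; have [c] := @MVT_segment R cos (fun t => - sin t) 0 x x0
  (fun t _ => is_derive_cos t) (continuous_subspaceT (@continuous_cos R)).
rewrite in_itv /= => /andP[c0 cx]; rewrite cos0 subr0 => cE.
by have := sin_le1 c; nra.
Qed.

(** Telescoping: 1/(x+1)^2 <= 1/x - 1/(x+1). *)
Lemma sum_inv_sqr_le m : \sum_(0 <= i < m.+1) i.+1%:R ^- 2 <= 2 - m.+1%:R^-1 :> R.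
Proof.
elim: m => [|m IH]; first by rewrite big_nat1 expr1n invr1; lra.
rewrite big_nat_recr//=; apply: le_trans (lerD IH (lexx _)) _.
rewrite -[m.+2]addn1 natrD mulr1n; set x : R := m.+1%:R.
have x0 : 0 < x by rewrite ltr0n.
suff : (x + 1) ^- 2 <= x^-1 - (x + 1)^-1.
  by move: ((x + 1) ^- 2) (x^-1) ((x + 1)^-1) => p q r h; lra.
have -> : x^-1 - (x + 1)^-1 = (x * (x + 1))^-1.
  by field; rewrite !gt_eqF// addr_gt0.
by rewrite lef_pV2 ?posrE ?mulr_gt0 ?exprn_gt0 ?addr_gt0//; nra.
Qed.

(* The middle term is [0 ^- 2 = 0]. *)
Lemma sum_inv_sqr_centered_le m :
  \sum_(k < m.*2.+1) (k%:R - m%:R) ^- 2 <= 4 :> R.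
Proof.
have B : \sum_(0 <= i < m) i.+1%:R ^- 2 <= 2 :> R.
  case: m => [|m]; first by rewrite big_geq.
  by apply: le_trans (sum_inv_sqr_le m) _; rewrite gerBl invr_ge0.
rewrite -(big_mkord xpredT (fun k => (k%:R - m%:R) ^- 2 : R)).
(* The sum is cut after its middle term; reversing the first half and shifting the second turns each
   into the sum bounded by [B]. *)
rewrite (big_cat_nat (n := m.+1))//=; last by rewrite ltnS -addnn leq_addr.
rewrite big_nat_recr//= subrr expr0n/= invr0 addr0.
rewrite -[m.+1 in X in _ + X]add0n big_addn subSS -addnn addnK.
rewrite [X in X + _]big_nat_rev /= add0n.
rewrite (_ : 4 = 2 + 2 :> R); last by ring.
rewrite lerD//.
  apply: le_trans B; rewrite big_nat [leRHS]big_nat; apply: ler_sum => i /andP[_ im].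
  by rewrite natrB// addrAC subrr sub0r sqrrN.
apply: le_trans B; apply: ler_sum => i _.
by rewrite addnS -addSn natrD addrK.
Qed.

End Sine.

(** * The N-th roots of z, N odd, and their distances to 1 *)

Section ApproximateRoots.
Variables (R : realType) (a b : R) (m : nat).
Local Notation N := (m.*2.+1).
Local Notation z := (cexp (a +i* b)).

(* With [N = 2m+1], these are the [N]-th roots of [cexp (a +i* b)]; the index
   [k = m] is the one close to 1. *)
Definition root_angle (k : nat) : R := (b + 2 * pi * (k%:R - m%:R)) / N%:R.
Definition croot (k : nat) : R[i] := cexp ((a / N%:R) +i* root_angle k).

Let N0 : N%:R != 0 :> R. Proof. by rewrite pnatr_eq0. Qed.
Let Ngt0 : 0 < N%:R :> R. Proof. by rewrite ltr0n. Qed.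

Lemma natrMc n (x y : R) : n%:R * (x +i* y) = (n%:R * x) +i* (n%:R * y).
Proof. by rewrite -(rmorph_nat (real_complex R) n); simpc. Qed.

Lemma croot_mid : croot m = cexp ((a / N%:R) +i* (b / N%:R)).
Proof. by rewrite /croot /root_angle subrr mulr0 addr0. Qed.

Lemma crootXN k : croot k ^+ N = z.
Proof.
rewrite /croot -cexp_natM natrMc.
have -> : N%:R * (a / N%:R) = a by rewrite mulrC divfK.
have -> : N%:R * root_angle k = b + 2 * pi * (k%:R - m%:R).
  by rewrite /root_angle mulrC divfK.
(* The exponents differ by 2 pi i (k - m), where k - m may be negative; adding 2 pi i m on the left
   and 2 pi i k on the right uses only natural multiples. *)
rewrite -[LHS]mulr1 -{1}(cexp_2piM R m) -cexpD -[RHS]mulr1 -(cexp_2piM R k) -cexpD.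
by congr cexp; simpc; congr (_ +i* _); ring.
Qed.

(** A geometric progression of ratio w = e^(2 pi i l / N), with w^N = 1. The ratio is not 1, because
    the half-angle pi l / N lies strictly between 0 and pi. *)
Lemma croot_sum l : (0 < l < N)%N -> \sum_(k < N) croot k ^+ l = 0.
Proof.
move=> /andP[l0 lN]; pose w : R[i] := cexp ((2 * pi / N%:R)*i) ^+ l.
have rootE k : croot k ^+ l = croot 0 ^+ l * w ^+ k.
  rewrite /w -exprM mulnC exprM -exprMn; congr (_ ^+ _).
  rewrite /croot -cexp_natM natrMc -cexpD; congr cexp.
  by rewrite /root_angle mulr0; simpc; congr (_ +i* _); field.
under eq_bigr => k _ do rewrite rootE.
rewrite -mulr_sumr.
have wN : w ^+ N = 1.
  rewrite /w exprAC -cexp_natM natrMc mulr0.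
  have -> : N%:R * (2 * pi / N%:R) = 2 * pi * 1%:R :> R by field.
  by rewrite cexp_2piM expr1n.
have w1 : w - 1 != 0.
  rewrite -normc_eq0 -sqrf_eq0 /w -cexp_natM natrMc mulr0 sqr_normc_cexpB1.
  rewrite expR0 subrr expr0n add0r mulr1 mulf_neq0// expf_neq0// gt_eqF//.
  have -> : l%:R * (2 * pi / N%:R) / 2 = pi * (l%:R / N%:R) :> R by field.
  rewrite sin_gt0_pi// mulr_gt0 ?pi_gt0 ?divr_gt0 ?ltr0n//=.
  by rewrite gtr_pMr ?pi_gt0// ltr_pdivrMr// mul1r ltr_nat.
apply/eqP; rewrite mulf_eq0; apply/orP; right.
by rewrite -(mulrI_eq0 _ (mulfI w1)) -subrX1 wN subrr.
Qed.

Hypothesis b_pi : `|b| < pi.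

(** With j = k - m, the triangle inequality places |b + 2 pi j| between 2 pi |j| - |b| and 2 pi |j|
    + |b|, while 1 <= |j| <= m and |b| < pi. Centring the index keeps every angle in [-pi, pi]. *)
Lemma root_angle_bounds (k : 'I_N) : k != m :> nat ->
  [/\ `|root_angle k| <= pi, (2 * pi - `|b|) / N%:R <= `|root_angle k| &
      pi * `|k%:R - m%:R| / N%:R <= `|root_angle k|].
Proof.
move=> km; have p0 := pi_gt0 R.
have j1 : 1 <= `|k%:R - m%:R| :> R.
  case: (ltngtP k m) km => // lt _.
    by rewrite distrC ger0_norm ?subr_ge0 ?ler_nat ?(ltnW lt)// -natrB ?(ltnW lt)// ler1n subn_gt0.
  by rewrite ger0_norm ?subr_ge0 ?ler_nat ?(ltnW lt)// -natrB ?(ltnW lt)// ler1n subn_gt0.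
have jm : `|k%:R - m%:R| <= m%:R :> R.
  rewrite ler_norml; apply/andP; split; first by rewrite lerBrDr addNr.
  by rewrite lerBlDr -natrD ler_nat addnn -ltnS ltn_ord.
have ne : N%:R = 2 * m%:R + 1 :> R by rewrite -addn1 natrD -mul2n natrM.
rewrite /root_angle normrM normfV (gtr0_norm Ngt0).
rewrite ler_pdivrMr// !ler_pM2r ?invr_gt0// ne.
move: (k%:R - m%:R) j1 jm => j j1 jm.
have jE : `|2 * pi * j| = 2 * (pi * `|j|).
  by rewrite mulrA normrM ger0_norm// mulr_ge0// ltW.
have hu := ler_normD b (2 * pi * j); have hl := lerB_normD (2 * pi * j) b.
rewrite [2 * pi * j + b]addrC in hl; rewrite jE in hu hl.
have h1 : pi * 1 <= pi * `|j| by rewrite ler_pM2l.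
have h2 : pi * `|j| <= pi * m%:R by rewrite ler_pM2l.
rewrite mulr1 in h1; rewrite (_ : pi * (2 * m%:R + 1) = 2 * (pi * m%:R) + pi :> R); last by ring.
have key (B T p q : R) : B < pi -> T <= B + 2 * p -> 2 * p - B <= T -> pi <= p ->
    p <= q -> [/\ T <= 2 * q + pi, 2 * pi - B <= T & p <= T].
  by move=> *; split; lra.
exact: key b_pi hu hl h1 h2.
Qed.

Let x := a / N%:R.

(** Both exponentials have modulus e^x, so by the half-angle formula only sines of half-angles are
    compared, on [0, pi/2] where sine increases. This bound, uniform in k, yields the geometric
    decay. *)
Lemma croot_dist_ge (k : 'I_N) : k != m :> nat ->
  nm (cexp (x +i* ((2 * pi - `|b|) / N%:R)) - 1) <= nm (croot k - 1).
Proof.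
move=> km; have [ap h1 _] := root_angle_bounds km; have p0 := pi_gt0 R.
rewrite -(@ler_pXn2r _ 2%N) ?nnegrE ?normc_ge0// !sqr_normc_cexpB1.
rewrite lerD2l ler_pM2l ?mulr_gt0 ?expR_gt0//.
rewrite -[leRHS]sin_sqr_norm normrM (gtr0_norm (x := 2^-1))//.
have b0 : 0 <= 2 * pi - `|b|.
  by rewrite subr_ge0 (le_trans (ltW b_pi))// ler_peMl ?ler1n ?pi_ge0.
have y0 : 0 <= (2 * pi - `|b|) / N%:R / 2 by rewrite !divr_ge0.
have yk : (2 * pi - `|b|) / N%:R / 2 <= `|root_angle k| / 2.
  by rewrite ler_pM2r.
have kp : `|root_angle k| / 2 <= pi / 2 by rewrite ler_pM2r.
have pp : pi / 2 <= pi :> R by lra.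
have yp := le_trans kp pp.
by rewrite ler_pXn2r ?nnegrE ?sin_le_mono// sin_ge0_pi// ?y0 ?(le_trans y0)// (le_trans yk).
Qed.

(** This bound grows with |k - m| and makes the sum over k bounded independently of N, up to the
    factor N^2. *)
Lemma croot_dist_ge_index (k : 'I_N) : k != m :> nat ->
  expR x * (k%:R - m%:R) ^+ 2 / N%:R ^+ 2 <= nm (croot k - 1) ^+ 2.
Proof.
move=> km; have [ap _ h1] := root_angle_bounds km; have p2 := pi_ge2 R.
rewrite sqr_normc_cexpB1 -[in leRHS]sin_sqr_norm normrM (gtr0_norm (x := 2^-1))//.
have t0 : 0 <= `|root_angle k| / 2 by rewrite divr_ge0.
have t1 : `|root_angle k| / 2 <= pi / 2 by rewrite ler_pM2r.
have s0 := sin_ge_half t0 t1.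
have j0 : 0 <= `|k%:R - m%:R| / N%:R :> R by rewrite divr_ge0.
(* The sine is at least |angle|/4 >= pi |k - m| / (4 N), and pi >= 2. *)
have s1 : `|k%:R - m%:R| / N%:R / 2 <= sin (`|root_angle k| / 2).
  apply: le_trans s0; rewrite ler_pM2r// ler_pdivlMr//.
  apply: le_trans h1; rewrite -[leRHS]mulrA mulrC ler_wpM2r//.
apply: ler_wpDl; first exact: sqr_ge0.
have : (`|k%:R - m%:R| / N%:R / 2) ^+ 2 <= sin (`|root_angle k| / 2) ^+ 2.
  rewrite ler_pXn2r ?nnegrE ?divr_ge0//; apply: le_trans s1; by rewrite divr_ge0.
rewrite !expr_div_n real_normK ?num_real// => h.
have := ler_wpM2l (ltW (mulr_gt0 (ltr0n R 4) (expR_gt0 x))) h.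
apply: le_trans; rewrite le_eqVlt; apply/orP; left; apply/eqP; field.
by rewrite nat1r pnatr_eq0.
Qed.

Hypothesis z1 : z != 1.

Lemma croot_neq1 k : croot k != 1.
Proof. by apply: contraNneq z1 => r1; rewrite -(crootXN k) r1 expr1n. Qed.

(** The term k = m contributes exactly [croot m]. In every other term, p of the p + 2 inverse
    factors are absorbed by [croot_dist_ge]; the last two, by [croot_dist_ge_index], give N^2 / (k -
    m)^2, whose sum is at most 4 N^2. *)
Lemma croot_sum_dominant p :
  nm (cexp (x +i* ((2 * pi - `|b|) / N%:R)) - 1) ^+ p *
    nm ((croot m - 1) ^+ p.+2 * \sum_(k < N) croot k * (croot k - 1) ^- p.+2
        - croot m) <=
  4 * N%:R ^+ 2 * nm (croot m - 1) ^+ p.+2.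
Proof.
have mN : (m < N)%N by rewrite ltnS -addnn leq_addr.
have t0 k : croot k - 1 != 0 by rewrite subr_eq0 croot_neq1.
have t0' k : 0 < nm (croot k - 1) by rewrite normc_gt0.
set t' := nm (cexp (_ +i* ((2 * pi - _) / _)) - 1).
rewrite (bigD1 (Ordinal mN)) // mulrDr [nat_of_ord (Ordinal mN)]/=.
rewrite mulrCA mulfV ?expf_neq0 // mulr1 addrAC subrr add0r.
set t := nm (croot m - 1).
have tge0 : 0 <= t by exact: normc_ge0.
have t'ge0 : 0 <= t' by exact: normc_ge0.
rewrite Normc.normcM normcX -/t mulrCA [leRHS]mulrC ler_wpM2l ?exprn_ge0//.
apply: (@le_trans _ _ (\sum_(k < N) N%:R ^+ 2 * (k%:R - m%:R) ^- 2)); last first.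
  rewrite -mulr_sumr mulrC ler_wpM2r ?exprn_ge0//.
  exact: sum_inv_sqr_centered_le.
(* At k = m the summand is 0, since the inverse of 0 is 0. *)
rewrite [leRHS](bigD1 (Ordinal mN))//= subrr expr0n invr0 mulr0 add0r.
apply: (@le_trans _ _ (t' ^+ p * \sum_(k < N | k != Ordinal mN)
    nm (croot k * (croot k - 1) ^- p.+2))).
  by rewrite ler_wpM2l ?exprn_ge0// normc_sum.
rewrite mulr_sumr; apply: ler_sum => k km.
have {}km : k != m :> nat by rewrite -val_eqE in km.
have h1 := croot_dist_ge km; have h2 := croot_dist_ge_index km.
rewrite -/t' in h1; rewrite Normc.normcM Normc.normcV normcX.
rewrite (_ : nm (croot k) = expR x); last exact: normc_cexp.
have j0 : 0 < (k%:R - m%:R) ^+ 2 :> R by rewrite exprn_even_gt0//= subr_eq0 eqr_nat.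
have h3 : t' ^+ p <= nm (croot k - 1) ^+ p by rewrite lerXn2r ?nnegrE ?normc_ge0.
move: (nm (croot k - 1)) (t0' k) h2 h3 => s s0 h2 h3.
rewrite mulrCA -[p.+2]addn2 exprD invfM.
have h4 : t' ^+ p * (s ^- p * s ^- 2) <= s ^- 2.
  by rewrite mulrA ler_piMl ?invr_ge0 ?exprn_ge0 ?(ltW s0)// ler_pdivrMr ?exprn_gt0// mul1r.
apply: (le_trans (ler_wpM2l (expR_ge0 _) h4)).
by rewrite ler_pdivrMr ?exprn_gt0// mulrAC ler_pdivlMr// [leRHS]mulrC -ler_pdivrMr ?exprn_gt0.
Qed.

End ApproximateRoots.

(** * Letting N tend to infinity *)

Section LimitOfRoots.
Variable R : realType.
Implicit Types (a b : R) (z : R[i]).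
Local Notation N m := (m.*2.+1).

Lemma cvg_oddV : (fun m => (N m)%:R^-1 : R) @ \oo --> (0 : R).
Proof.
apply: (@squeeze_cvgr _ _ _ _ (fun=> 0) (@harmonic R)).
- apply: nearW => m; rewrite invr_ge0 ler0n /= lef_pV2 ?posrE ?ltr0n//.
  by rewrite ler_nat ltnS -addnn leq_addr.
- exact: cvg_cst.
- exact: cvg_harmonic.
Qed.

Lemma cvg_odd_ratio j : (fun m => (N m - j)%:R / (N m)%:R : R) @ \oo --> (1 : R).
Proof.
have H : (fun m => 1 - j%:R * (N m)%:R^-1 : R) @ \oo --> (1 : R).
  rewrite -[X in _ --> X]subr0 -(mulr0 (j%:R : R)).
  apply: cvgB; first exact: cvg_cst.
  by apply: cvgM; [exact: cvg_cst|exact: cvg_oddV].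
apply: cvg_trans H; apply: near_eq_cvg; exists j => // m /= jm.
rewrite natrB ?mulrBl ?divff ?pnatr_eq0//.
by rewrite (leq_trans jm)// ltnW// ltnS -addnn leq_addr.
Qed.

Lemma cvgc_real (u : nat -> R) a :
  u @ \oo --> a -> (fun n => (u n)%:C) @ \oo --> a%:C.
Proof. by move=> H; exact: (cvg_complex H (cvg_cst 0)). Qed.

(** Induction on j through (j + 1) C(N, j + 1) = (N - j) C(N, j). *)
Lemma cvg_bin_scaled j :
  (fun m => 'C(N m, j)%:R / (N m)%:R ^+ j : R[i]) @ \oo --> (j`!%:R^-1 : R[i]).
Proof.
elim: j => [|j IH].
  have -> : (fun m => 'C(N m, 0)%:R / (N m)%:R ^+ 0 : R[i]) = fun=> 1.
    by apply/funext => m; rewrite bin0 expr0 divr1.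
  by rewrite fact0 invr1; exact: cvg_cst.
have -> : (fun m => 'C(N m, j.+1)%:R / (N m)%:R ^+ j.+1 : R[i]) =
    (fun m => 'C(N m, j)%:R / (N m)%:R ^+ j * (((N m - j)%:R / (N m)%:R)%:C * j.+1%:R^-1)).
  apply/funext => m; have := mul_bin_left (N m) j.
  move=> /(congr1 (fun n => n%:R : R[i])); rewrite !natrM => h.
  rewrite rmorphM fmorphV !rmorph_nat exprSr.
  have j0 : j.+1%:R != 0 :> R[i] by rewrite pnatr_eq0.
  have n0 : (N m)%:R != 0 :> R[i] by rewrite pnatr_eq0.
  apply: (mulfI j0); rewrite mulrA h.
  have key (B D t x y : R[i]) : t != 0 -> x != 0 -> y != 0 ->
      D * B / (t * x) = y * (B / t * (D / x * y^-1)).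
    by move=> t0 x0 y0; field; rewrite t0 x0 y0.
  by apply: key => //; rewrite expf_neq0.
have -> : (j.+1)`!%:R^-1 = j`!%:R^-1 * (1%:C * j.+1%:R^-1) :> R[i].
  by rewrite factS natrM invfM rmorph1 mul1r mulrC.
apply: (cvgM IH); apply: cvgM; last exact: cvg_cst.
exact/cvgc_real/cvg_odd_ratio.
Qed.

(** The term of index n enters with factor 1 - z, which is nonzero, so each recurrence expresses it
    through earlier terms. Strong induction carries convergence of the coefficients over to the
    solutions, without any convergence of functions. *)
Lemma cvg_recurrence (p c d : nat -> R[i]) (P C : nat -> nat -> R[i]) z :
  z != 1 -> p 0%N = 1 -> (forall m, P m 0%N = 1) ->
  (forall j, P ^~ j @ \oo --> p j) ->
  (forall n, \sum_(j < n.+1) p j * c (n - j)%N - z * c n = d n) ->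
  (forall m n, (n < m)%N ->
    \sum_(j < n.+1) P m j * C m (n - j)%N - z * C m n = d n) ->
  forall n, C ^~ n @ \oo --> c n.
Proof.
move=> z1 p0 P0 Pp cE CE n; have z1' : 1 - z != 0 by rewrite subr_eq0 eq_sym.
elim/ltn_ind: n => n IH.
have solve (q e : nat -> R[i]) : q 0%N = 1 ->
    \sum_(j < n.+1) q j * e (n - j)%N - z * e n = d n ->
    e n = (d n - \sum_(j < n) q j.+1 * e (n - j.+1)%N) / (1 - z).
  move=> q0; rewrite big_ord_recl q0 subn0 mul1r => <-.
  apply: (mulIf z1'); rewrite mulfVK//.
  by move: (\sum_(i < n) _) => S; ring.
rewrite (solve _ _ p0 (cE n)).
have H : (fun m => (d n - \sum_(j < n) P m j.+1 * C m (n - j.+1)%N) / (1 - z)) @ \oo -->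
    (d n - \sum_(j < n) p j.+1 * c (n - j.+1)%N) / (1 - z).
  apply: cvgM; last exact: cvg_cst.
  apply: cvgB; first exact: cvg_cst.
  apply: (cvg_sumc (F := fun (j : 'I_n) m => P m j.+1 * C m (n - j.+1)%N)) => j.
  apply: (cvgM (Pp _)); apply: IH.
  by rewrite ltn_subrL/= (leq_ltn_trans _ (ltn_ord j)).
apply: cvg_trans H; apply: near_eq_cvg; exists n.+1 => // m /= nm.
by rewrite -(solve _ _ (P0 m) (CE m n nm)).
Qed.

Lemma cvg_diff_quotient (f : R -> R) (x df : R) (u : nat -> R) :
  is_derive x 1 f df -> u @ \oo --> (0 : R) -> (forall n, u n != 0) ->
  (fun n => (u n)^-1 * (f (u n + x) - f x)) @ \oo --> df.
Proof.
move=> [Hd <-] Hu u0.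
have Hu' : u @ \oo --> (0 : R)^'.
  move=> A HA; have : \forall n \near \oo, u n != 0 -> A (u n) := Hu _ HA.
  by apply: filterS => n; exact.
have := cvg_comp _ _ Hu' Hd; rewrite -/(derive f x 1).
have -> // : (fun h => h^-1 *: ((f \o shift x) (h *: 1) - f x)) \o u =
  (fun n => (u n)^-1 * (f (u n + x) - f x)).
by apply/funext => n /=; rewrite [u n *: 1]mulr1.
Qed.

(** This is the derivative at 0 of e^(t (a + ib)) along t = 1/N, taken separately on real and
    imaginary parts. *)
Lemma cvg_cexp_scaled a b :
  (fun m => (N m)%:R * (cexp ((a / (N m)%:R) +i* (b / (N m)%:R)) - 1)) @ \oo -->
  (a +i* b).
Proof.
pose u m : R := (N m)%:R^-1.
have u0 m : u m != 0 by rewrite invr_neq0// pnatr_eq0.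
have Dc : is_derive (0 : R) 1 (fun t => expR (a * t) * cos (b * t)) a.
  apply: is_derive_eq; rewrite !mulr0 expR0 cos0 sin0 /=.
  by rewrite !scale1r oppr0 mul0r add0r mul1r; exact: mulr1.
have Ds : is_derive (0 : R) 1 (fun t => expR (a * t) * sin (b * t)) b.
  apply: is_derive_eq; rewrite !mulr0 expR0 cos0 sin0 /=.
  by rewrite scale0r addr0 scale1r mul1r; exact: mulr1.
have H := cvg_complex (cvg_diff_quotient Dc cvg_oddV u0)
  (cvg_diff_quotient Ds cvg_oddV u0).
rewrite (_ : (fun m => _ * _) = fun m =>
  ((u m)^-1 * (expR (a * (u m + 0)) * cos (b * (u m + 0)) -
     expR (a * 0) * cos (b * 0))) +i*
  ((u m)^-1 * (expR (a * (u m + 0)) * sin (b * (u m + 0)) -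
     expR (a * 0) * sin (b * 0)))); first exact: H.
apply/funext => m.
rewrite !addr0 !mulr0 expR0 cos0 sin0 mul1r mulr0 subr0 invrK.
rewrite /cexp -(rmorph1 (real_complex R)) -(rmorph_nat (real_complex R)).
by simpc.
Qed.

(* The Taylor coefficients of [(1 - z) / ((1 + s/N)^N - z)], [z = e^(a + ib)]. *)
Definition approx_coef a b m n : R[i] :=
  let z := cexp (a +i* b) in
  (z - 1) / z / (N m)%:R ^+ n.+1 *
    \sum_(k < N m) croot a b m k * (croot a b m k - 1) ^- n.+1.

(** [root_sum_rec] after the rescaling s = N (rho - 1); the prefactor (z - 1) / z turns -N z into 1
    - z. *)
Lemma approx_coef_rec a b m n : cexp (a +i* b) != 1 -> (n < N m)%N ->
  \sum_(j < n.+1) 'C(N m, j)%:R / (N m)%:R ^+ j * approx_coef a b m (n - j)%N -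
    cexp (a +i* b) * approx_coef a b m n =
  if n == 0%N then 1 - cexp (a +i* b) else 0.
Proof.
move=> z1 nN; set z := cexp _.
have z0 : z != 0 by rewrite -normc_gt0 normc_cexp expR_gt0.
have n0 : (N m)%:R != 0 :> R[i] by rewrite pnatr_eq0.
pose e i : R[i] := \sum_(k < N m) croot a b m k * (croot a b m k - 1) ^- i.+1.
have : \sum_(j < n.+1) 'C(N m, j)%:R * e (n - j)%N - z * e n =
    if n == 0%N then - ((N m)%:R * z) else 0.
  exact: (@root_sum_rec _ (N m) z (fun k => croot a b m k)
    (fun k => crootXN a b m k) (fun k => croot_neq1 m z1 k) (@croot_sum _ a b m)).
move=> /(congr1 (fun w => (z - 1) / z / (N m)%:R ^+ n.+1 * w)).
rewrite mulrBr mulr_sumr => H.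
transitivity ((z - 1) / z / (N m)%:R ^+ n.+1 *
    (if n == 0%N then - ((N m)%:R * z) else 0)); last first.
  case: eqP => [->|_]; last by rewrite mulr0.
  by rewrite expr1; move: ((N m)%:R : R[i]) n0 => w w0; field; rewrite z0 w0.
rewrite -H; congr (_ - _); last by rewrite /approx_coef -/(e n) mulrCA.
apply: eq_bigr => -[j /= jn] _; rewrite /approx_coef -/(e (n - j)%N) -/z.
have -> : n.+1 = (j + (n - j).+1)%N by rewrite addnS subnKC.
rewrite exprD.
have := expf_neq0 j n0; have := expf_neq0 (n - j).+1 n0.
move: (_ ^+ j) (_ ^+ _) (e _) ('C(_, _)%:R) => x y u v y0 x0; field.
by rewrite x0 y0 z0.
Qed.

(* All poles of [(1 - z) / (e^s - z)], [z = e^(a + ib)], other than [a + ib] lie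
   at distance at least [|a + i(2 pi - |b|)|] from 0. *)
Lemma dominant_pole a b (c : nat -> R[i]) : `|b| < pi ->
  let z := cexp (a +i* b) in let L := a +i* b in z != 1 ->
  (forall n, \sum_(j < n.+1) j`!%:R^-1 * c (n - j)%N - z * c n =
    if n == 0%N then 1 - z else 0) ->
  forall p, nm (a +i* (2 * pi - `|b|)) ^+ p *
      nm (L ^+ p.+2 * (c p.+1 * (z / (z - 1))) - 1) <= 4 * nm L ^+ p.+2.
Proof.
move=> bpi z L z1 cE p.
have z0 : z != 0 by rewrite -normc_gt0 normc_cexp expR_gt0.
have zB1 : z - 1 != 0 by rewrite subr_eq0.
have n0 m : (N m)%:R != 0 :> R[i] by rewrite pnatr_eq0.
have Hc : (fun m => approx_coef a b m p.+1) @ \oo --> c p.+1.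
  apply: (@cvg_recurrence (fun j => j`!%:R^-1) c (fun n => if n == 0%N then 1 - z else 0)
    (fun m j => 'C(N m, j)%:R / (N m)%:R ^+ j) (approx_coef a b) z z1 _ _ _ cE).
  - by rewrite fact0 invr1.
  - by move=> m; rewrite bin0 expr0 divr1.
  - exact: cvg_bin_scaled.
  - by move=> m n nm; apply: approx_coef_rec => //; rewrite (ltn_trans nm)// ltnS -addnn leq_addr.
(* The zero of (1 + s/N)^N - z that tends to the pole L. *)
pose s m := (N m)%:R * (croot a b m m - 1).
have Hs : s @ \oo --> L.
  have -> : s = fun m => (N m)%:R * (cexp ((a / (N m)%:R) +i* (b / (N m)%:R)) - 1).
    by apply/funext => m; rewrite /s croot_mid.
  exact: cvg_cexp_scaled.
have Hr : (fun m => croot a b m m) @ \oo --> (1 : R[i]).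
  have -> : (fun m => croot a b m m) = (fun m => 1 + (N m)%:R^-1 * s m).
    by apply/funext => m; rewrite /s mulrA mulVf// mul1r addrC subrK.
  rewrite -[X in _ --> X]addr0 -[X in _ --> _ + X](mul0r L).
  apply: cvgD; first exact: cvg_cst.
  apply: cvgM; last exact: Hs.
  have := cvgc_real cvg_oddV.
  have -> // : (fun m => ((N m)%:R^-1 : R)%:C) = (fun m => (N m)%:R^-1 : R[i]).
  by apply/funext => m; rewrite fmorphV rmorph_nat.
have Ht := @cvg_cexp_scaled a (2 * pi - `|b|).
(* Its modulus bounds those of the other zeros from below, and it tends to a + i(2 pi - |b|). *)
pose t m : R[i] := (N m)%:R * (cexp ((a / (N m)%:R) +i* ((2 * pi - `|b|) / (N m)%:R)) - 1).
have HE : (fun m => s m ^+ p.+2 * (approx_coef a b m p.+1 * (z / (z - 1))) -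
    croot a b m m) @ \oo --> (L ^+ p.+2 * (c p.+1 * (z / (z - 1))) - 1).
  exact: (cvgB (cvgM (cvg_Xc Hs) (cvgM Hc (cvg_cst (z / (z - 1))))) Hr).
(* Rescaling puts N^p on the left and N^(p+2) on the right, which exactly absorbs the N^2 lost in
   [croot_sum_dominant]. *)
have bound m : nm (t m) ^+ p * nm (s m ^+ p.+2 *
    (approx_coef a b m p.+1 * (z / (z - 1))) - croot a b m m) <= 4 * nm (s m) ^+ p.+2.
  have H := croot_sum_dominant m bpi z1 p.
  have normN : nm (N m)%:R = (N m)%:R :> R.
    by rewrite -(rmorph_nat (real_complex R)) normcR ger0_norm.
  have -> : s m ^+ p.+2 * (approx_coef a b m p.+1 * (z / (z - 1))) =
      (croot a b m m - 1) ^+ p.+2 *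
      \sum_(k < N m) croot a b m k * (croot a b m k - 1) ^- p.+2.
    rewrite /s exprMn /approx_coef -/z; have := expf_neq0 p.+2 (n0 m).
    move: ((N m)%:R ^+ p.+2 : R[i]) ((_ - 1) ^+ _) (\sum_(k < N m) _) => x y w x0; field.
    by rewrite x0 z0 zB1.
  rewrite /t /s !Normc.normcM normN !exprMn -mulrA.
  apply: (le_trans (ler_wpM2l (exprn_ge0 _ (ler0n _ _)) H)).
  rewrite -[p.+2]addn2 [(N m)%:R ^+ (p + 2)]exprD le_eqVlt; apply/orP; left; apply/eqP.
  by ring.
have lhs : (fun m => nm (t m) ^+ p * nm (s m ^+ p.+2 *
    (approx_coef a b m p.+1 * (z / (z - 1))) - croot a b m m)) @ \oo -->
    nm (a +i* (2 * pi - `|b|)) ^+ p * nm (L ^+ p.+2 * (c p.+1 * (z / (z - 1))) - 1).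
  exact: (cvgM (cvg_normcX Ht) (cvg_normc HE)).
have rhs : (fun m => 4 * nm (s m) ^+ p.+2) @ \oo --> 4 * nm L ^+ p.+2.
  exact: (cvgM (cvg_cst (4 : R)) (cvg_normcX Hs)).
exact: (ler_cvg_to lhs rhs (nearW _ bound)).
Qed.

End LimitOfRoots.

(** * Compact subsets of the slit plane *)

Section SlitPlane.
Variable R : realType.
Implicit Types z : R[i].

Lemma lipschitz_continuous (f : R[i] -> R) (k : R) : 0 < k ->
  (forall x y, `|f x - f y| <= k * nm (x - y)) -> continuous f.
Proof.
move=> k0 H x B /nbhs_ballP[e /= e0 sB].
apply/nbhs_ballP; exists (e / k)%:C; first by rewrite /= ltcR divr_gt0.
move=> y; rewrite /ball /= normE ltcR ltr_pdivlMr// mulrC => h.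
by apply: sB; exact: le_lt_trans (H x y) h.
Qed.

Lemma Re_le_normc z : `|complex.Re z| <= nm z.
Proof. by rewrite -lecR -normE normc_ge_Re. Qed.

(** Re z + |z| vanishes only on the slit. It is continuous, unlike the argument, so on a compact set
    it has a positive minimum. *)
Lemma slit_plane_gt0 z : slit_plane z -> 0 < complex.Re z + nm z.
Proof.
move=> Sz; rewrite lt0r; apply/andP; split; last first.
  by rewrite -lerBlDl sub0r (le_trans _ (Re_le_normc z))// -normrN ler_norm.
apply/eqP => h; apply: Sz => /=.
have nE : nm z = - complex.Re z by apply/eqP; rewrite -addr_eq0 addrC h.
have re0 : complex.Re z <= 0 by rewrite -oppr_ge0 -nE normc_ge0.
split=> //; apply/eqP; rewrite -sqrf_eq0.
have : nm z ^+ 2 = complex.Re z ^+ 2 + complex.Im z ^+ 2.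
  by case: (z) => x y; rewrite sqr_sqrtr// addr_ge0// sqr_ge0.
by rewrite nE sqrrN => /eqP; rewrite -subr_eq0 opprD addrA subrr sub0r oppr_eq0.
Qed.

Lemma compact_slit_plane_bounds (K : set R[i]) : compact K ->
  K `<=` @slit_plane R ->
  exists r B : R, [/\ 0 < r, 0 < B &
    forall z, K z -> r <= complex.Re z + nm z /\ nm z <= B].
Proof.
move=> cK sK; have [[z0 Kz0]|K0] := pselect (K !=set0); last first.
  by exists 1, 1; split=> // z Kz; exfalso; apply: K0; exists z.
have cn : continuous (fun z : R[i] => nm z).
  by apply: (lipschitz_continuous ltr01) => x y; rewrite mul1r dist_normc.
have ch : continuous (fun z : R[i] => complex.Re z + nm z).
  apply: (lipschitz_continuous (ltr0n R 2)) => x y.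
  have -> : complex.Re x + nm x - (complex.Re y + nm y) =
      complex.Re (x - y) + (nm x - nm y).
    by case: x y => [? ?] [? ?] /=; rewrite opprD addrACA.
  apply: (le_trans (ler_normD _ _)); rewrite mulr2n mulrDl !mul1r.
  by rewrite lerD ?Re_le_normc ?dist_normc.
have K0 : K !=set0 by exists z0.
have [u /set_mem Ku hu] := compact_EVT_min K0 cK (continuous_subspaceT ch).
have [v _ hv] := compact_EVT_max K0 cK (continuous_subspaceT cn).
(* The added 1 makes the upper bound positive even for K = {0}-like maxima of size 0. *)
exists (complex.Re u + nm u), (nm v + 1); split.
- exact/slit_plane_gt0/sK.
- by rewrite ltr_wpDl ?normc_ge0.
move=> z Kz; split; first by apply: hu; exact/mem_set.
by rewrite ler_wpDr// hv//; exact/mem_set.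
Qed.

Lemma carg_norm_acos z : z != 0 ->
  [/\ 0 <= `|carg z|, `|carg z| <= pi & cos `|carg z| = complex.Re z / nm z].
Proof.
move=> z0; have r0 : 0 < nm z by rewrite normc_gt0.
have ar : -1 <= complex.Re z / nm z <= 1.
  by rewrite -ler_norml normrM normfV (gtr0_norm r0) ler_pdivrMr// mul1r Re_le_normc.
have aE : `|carg z| = acos (complex.Re z / nm z).
  by rewrite /carg; case: ifP => _; rewrite ?normrN ger0_norm// acos_ge0.
by rewrite aE acos_ge0// acos_lepi// acosK// in_itv.
Qed.

(** For u = pi - |arg z| one has cos u = - Re z / |z|, and 1 - u <= cos u. *)
Lemma carg_gap z : z != 0 -> (complex.Re z + nm z) / nm z <= pi - `|carg z|.
Proof.
move=> z0; have [a0 ap cE] := carg_norm_acos z0.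
have r0 : 0 < nm z by rewrite normc_gt0.
have : 0 <= pi - `|carg z| by rewrite subr_ge0.
move=> /cos_ge1Bx; rewrite cosB cospi sinpi mul0r addr0 cE mulN1r mulrDl divff ?gt_eqF//.
move: (pi - _) (_ / _) => u v; lra.
Qed.

End SlitPlane.

(** * Uniform geometric convergence on compact sets *)

Section Uniform.
Variables (R : realType) (A : nat -> {poly R[i]}).
Hypothesis hA : is_eulerian A.

(** Off the slit |arg z| < pi, so [dominant_pole] applies with a + ib = log z; the factor (z - 1) /
    z converts its relative error into an absolute one. *)
Lemma eulerian_ratio_dist (z : R[i]) p : slit_plane z -> z != 1 ->
  nm (eulerian_ratio A p.+1 z - (z - 1) / z) *
    nm (ln (nm z) +i* (2 * pi - `|carg z|)) ^+ p <=
  nm ((z - 1) / z) * (4 * nm (clog z) ^+ p.+2).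
Proof.
move=> Sz z1; have z0 : z != 0.
  by apply/eqP => zE; apply: Sz; rewrite zE /= lexx.
have bpi : `|carg z| < pi.
  have := carg_gap z0; have := slit_plane_gt0 Sz => h1 h2.
  rewrite -subr_gt0; apply: lt_le_trans h2.
  by rewrite divr_gt0// normc_gt0.
have zE := clogK z0; rewrite /clog in zE.
have := dominant_pole (a := ln (nm z)) bpi; rewrite zE => /(_ _ z1 (eulerian_recurrence hA z1) p) H.
rewrite (_ : eulerian_ratio A p.+1 z - (z - 1) / z = (z - 1) / z *
  (clog z ^+ p.+2 * ((A p.+1).[z] / p.+1`!%:R / (z - 1) ^+ p.+1 * (z / (z - 1))) - 1)).
  by rewrite Normc.normcM -mulrA ler_wpM2l ?normc_ge0// mulrC.
have zB1 : z - 1 != 0 by rewrite subr_eq0.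
rewrite /eulerian_ratio (negbTE z1) mulrBr mulr1; congr (_ - _).
have := expf_neq0 p.+1 zB1.
have : p.+1`!%:R != 0 :> R[i] by rewrite pnatr_eq0 -lt0n fact_gt0.
move: (p.+1`!%:R : R[i]) ((z - 1) ^+ p.+1) (clog z ^+ p.+2) => x y w x0 y0; field.
by rewrite x0 y0 z0 zB1.
Qed.

Lemma eulerian_ratio_geometric (K : set R[i]) : compact K ->
  K `<=` @slit_plane R -> exists C q : R, [/\ 0 <= q, q < 1 &
    forall z p, K z -> nm (eulerian_ratio A p.+1 z - (z - 1) / z) <= C * q ^+ p].
Proof.
move=> cK sK; have [r [B [r0 B0 HK]]] := compact_slit_plane_bounds cK sK.
pose D : R := `|ln (r / 2)| + `|ln B|.
(* [D] bounds |ln |z||. With L = log z and L' = ln |z| + i(2 pi - |arg z|), |L'|^2 - |L|^2 = 4 pi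
   (pi - |arg z|) >= 4 pi r / B and |L'|^2 <= D^2 + 4 pi^2, so [q2] bounds (|L| / |L'|)^2. *)
pose q2 : R := 1 - 4 * pi * (r / B) / (D ^+ 2 + 4 * pi ^+ 2).
have p0 := pi_gt0 R.
have D0 : 0 < D ^+ 2 + 4 * pi ^+ 2.
  by rewrite ltr_wpDl ?sqr_ge0// mulr_gt0// exprn_gt0.
(* The first factor bounds |(z - 1) / z|, since r <= Re z + |z| <= 2 |z|; the second bounds 4
   |L|^2. *)
exists ((B + 1) / (r / 2) * (4 * (D ^+ 2 + pi ^+ 2))), (Num.sqrt q2); split.
- exact: sqrtr_ge0.
- rewrite -[ltRHS]sqrtr1 ltr_sqrt// ltrBlDr ltrDl.
  by rewrite divr_gt0// mulr_gt0 ?divr_gt0// mulr_gt0.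
move=> z p Kz; have [hr hB] := HK z Kz; have Sz := sK z Kz.
have z0 : z != 0 by apply/eqP => zE; apply: Sz; rewrite zE /= lexx.
have nz0 : 0 < nm z by rewrite normc_gt0.
have nzr : r / 2 <= nm z.
  rewrite ler_pdivrMr// mulr_natr mulr2n (le_trans hr)// lerD2r.
  exact: le_trans (ler_norm _) (Re_le_normc z).
have r20 : 0 < r / 2 by rewrite divr_gt0.
have h1 : nm ((z - 1) / z) <= (B + 1) / (r / 2).
  rewrite Normc.normcM Normc.normcV ler_pM ?invr_ge0 ?normc_ge0//.
    by apply: le_trans (le_normcD _ _) _; rewrite normcN Normc.normc1 lerD2r.
  by rewrite lef_pV2.
have [a0 ap _] := carg_norm_acos z0.
have gap : r / B <= pi - `|carg z|.
  apply: le_trans (carg_gap z0).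
  by rewrite ler_pM ?invr_ge0 ?(ltW r0) ?(ltW B0)// lef_pV2.
have lnD : ln (nm z) ^+ 2 <= D ^+ 2.
  rewrite -real_normK ?num_real// lerXn2r ?nnegrE ?addr_ge0//.
  have l1 : ln (r / 2) <= ln (nm z) by rewrite ler_ln.
  have l2 : ln (nm z) <= ln B by rewrite ler_ln.
  rewrite ler_norml; apply/andP; split.
    apply: le_trans l1; rewrite /D opprD.
    by rewrite ler_wnDr ?oppr_le0// lerNl -normrN ler_norm.
  by apply: (le_trans l2); rewrite /D ler_wpDl// ler_norm.
have sqn u v : nm (u +i* v) ^+ 2 = u ^+ 2 + v ^+ 2 :> R.
  by rewrite sqr_sqrtr// addr_ge0// sqr_ge0.
have LE : nm (clog z) ^+ 2 = ln (nm z) ^+ 2 + `|carg z| ^+ 2.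
  by rewrite sqn real_normK ?num_real.
have L'E := sqn (ln (nm z)) (2 * pi - `|carg z|).
set L' := nm (_ +i* _) in L'E.
move: `|carg z| (ln (nm z) ^+ 2) (sqr_ge0 (ln (nm z))) a0 ap gap lnD LE L'E => b a2 a20 b0 bp gap lnD LE L'E.
have rB0 : 0 < r / B by rewrite divr_gt0.
have L'0 : 0 < L' ^+ 2.
  by rewrite L'E; apply: ltr_wpDl => //; rewrite exprn_gt0//; lra.
have q2E : nm (clog z) ^+ 2 / L' ^+ 2 <= q2.
  rewrite ler_pdivrMr// LE /q2 mulrBl mul1r.
  rewrite lerBrDl -lerBrDr.
  have -> : L' ^+ 2 - (a2 + b ^+ 2) = 4 * pi * (pi - b) by rewrite L'E; ring.
  have LD : L' ^+ 2 / (D ^+ 2 + 4 * pi ^+ 2) <= 1.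
    rewrite ler_pdivrMr// mul1r L'E lerD//.
    rewrite (_ : 4 * pi ^+ 2 = (2 * pi) ^+ 2); last by ring.
    by rewrite lerXn2r ?nnegrE; lra.
  have c0 : 0 <= 4 * pi * (r / B) by rewrite ltW// mulr_gt0// mulr_gt0.
  rewrite mulrAC -mulrA; apply: (le_trans (ler_wpM2l c0 LD)).
  by rewrite mulr1 ler_pM2l// mulr_gt0.
have nL' : 0 < L' by rewrite lt0r normc_ge0 andbT -sqrf_eq0 gt_eqF.
have qL : nm (clog z) <= Num.sqrt q2 * L'.
  rewrite -ler_pdivrMr//; apply: le_trans (ler_wsqrtr q2E).
  by rewrite -expr_div_n sqrtr_sqr ler_norm.
(* At z = 1 the ratio and its limit are both 0. *)
have [z1|z1] := eqVneq z 1.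
  rewrite /eulerian_ratio z1 eqxx subrr mul0r subrr Normc.normc0.
  rewrite mulr_ge0 ?exprn_ge0 ?sqrtr_ge0// mulr_ge0 ?divr_ge0 ?addr_ge0 ?ltW//.
  by rewrite mulr_gt0// ltr_wpDl ?sqr_ge0 ?exprn_gt0.
have := eulerian_ratio_dist p Sz z1; rewrite -/L' -ler_pdivlMr ?exprn_gt0// => /le_trans; apply.
rewrite ler_pdivrMr ?exprn_gt0// -2![leRHS]mulrA ler_pM ?normc_ge0//.
  by rewrite mulr_ge0 ?exprn_ge0 ?normc_ge0.
rewrite -[leRHS]mulrA ler_pM2l// -exprMn -[p.+2]addn2 exprD mulrC ler_pM ?exprn_ge0 ?normc_ge0//.
  rewrite LE lerD// lerXn2r ?nnegrE//.
  lra.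
by rewrite lerXn2r ?nnegrE ?normc_ge0// mulr_ge0 ?sqrtr_ge0 ?normc_ge0.
Qed.

End Uniform.

Unset Implicit Arguments.
Set Strict Implicit.
Set Printing Implicit Defensive.

Theorem theorem6 (R : realType) (A : nat -> {poly R[i]})
    (hA : is_eulerian A) (K : set R[i]) (cK : compact K)
    (sK : K `<=` @slit_plane R) :
  {uniform K, eulerian_ratio A @ \oo --> (fun z : R[i] => (z - 1) / z)}.
Proof.
have [C [q [q0 q1 H]]] := eulerian_ratio_geometric hA cK sK.
move=> P /uniform_nbhs[E [entE sub]].
move: entE; rewrite -entourage_from_ballE => -[e' /= e'0 sE].
move: e'0 sE; case: e' => e e2; rewrite ltcE /= => /andP[/eqP-> e0] sE {e2}.
have Hg : (fun n => C * q ^+ n) @ \oo --> (0 : R).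
  by apply: cvg_geometric; rewrite ger0_norm.
move/cvgrPdist_lt : Hg => /(_ _ e0)[n0 _ Hn].
(* The geometric bound concerns the index p + 1, hence the threshold shifted by one. *)
exists n0.+1 => // -[//|n] /= n0n; apply: sub => z Kz.
apply: sE; rewrite /ball /= normE ltcR normcBC.
apply: le_lt_trans (H z n Kz) _.
have := Hn n n0n; rewrite /= sub0r normrN; exact: le_lt_trans (ler_norm _).
Qed.
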